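(* Let $\beta,\gamma\in[0,2)$ with $\beta+\gamma<2$, and for $n\ge 0$ and $x\in[-1,1]$ let $$T_n^{\beta,\gamma}(x)=\cos\left(\frac{2n}{2-\beta-\gamma}\left(\arccos x-\frac{\gamma\pi}{2}\right)\right).$$ Then for every integer $n\ge 1$ and all $x,y\in[-1,1]$ with $T_1^{\beta,\gamma}(x)\neq T_1^{\beta,\gamma}(y)$, $${\sum_{j=0}^n}^{\prime} T^{\beta,\gamma}_j(x)\,T^{\beta,\gamma}_j(y)=\frac{1}{2}\,\frac{T^{\beta,\gamma}_{n+1}(x)T^{\beta,\gamma}_n(y)-T^{\beta,\gamma}_n(x)T^{\beta,\gamma}_{n+1}(y)}{T^{\beta,\gamma}_1(x)-T^{\beta,\gamma}_1(y)}.$$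
   Context: The primed sum denotes the sum with its first term halved: ${\sum_{j=0}^n}^{\prime} z_j := \frac12 z_0+z_1+\dots+z_n$. The functions $T_n^{\beta,\gamma}$ are called the $(\beta,\gamma)$-Chebyshev functions of the first kind on $[-1,1]$. *)

(* Defs.v *)
From HB Require Import structures.
From mathcomp Require Import all_boot all_order all_algebra.
From mathcomp Require Import all_classical all_reals all_analysis.

Set Implicit Arguments.
Unset Strict Implicit.
Unset Printing Implicit Defensive.

Import Order.TTheory GRing.Theory Num.Theory.

Local Open Scope ring_scope.

(* The (beta, gamma)-Chebyshev function of the first kind. It is meaningful
   only for x in [-1, 1], where [acos] is the arccosine with values in [0, pi];
   the definition is total because [acos] is. *)
Definition chebT (R : realType) (beta gamma : R) (n : nat) (x : R) : R :=
  cos (2 * n%:R / (2 - beta - gamma) * (acos x - gamma * pi / 2)).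

(* Sum of z_0, ..., z_n (both ends included) with the first term halved. *)
Definition primed_sum (R : realType) (n : nat) (z : nat -> R) : R :=
  2^-1 * z 0%N + \sum_(1 <= j < n.+1) z j.

(* Main.v *)
Require Import Defs.
From mathcomp Require Import all_boot all_order all_algebra.
From mathcomp Require Import all_classical all_reals all_analysis.
From mathcomp Require Import ring.

(** Put [theta(x) = 2 / (2 - beta - gamma) * (acos x - gamma * pi / 2)], so that
    [chebT beta gamma n x = cos (n * theta(x))].  The sum-to-product formula for
    [cos ((n + 2) * theta) + cos (n * theta)] is the classical three-term
    recurrence [T_(n+2) = 2 T_1 T_(n+1) - T_n] (lemma [chebT_rec]), with
    [T_0 = 1].  The Christoffel-Darboux identity is a formal consequence of this
    recurrence (lemma [christoffel_darboux]): after multiplication by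
    [2 (T_1(x) - T_1(y))], the [j]-th term of the sum is the difference of two
    consecutive values of [T_(j+1)(x) T_j(y) - T_j(x) T_(j+1)(y)], so the sum
    telescopes.  The halved first term matches the initial value
    [T_1(x) - T_1(y)]. *)

Import Order.TTheory GRing.Theory Num.Theory.

Local Open Scope ring_scope.

Lemma chebT0 (R : realType) (beta gamma x : R) : chebT beta gamma 0 x = 1.
Proof. by rewrite /chebT mulr0 !mul0r cos0. Qed.

Lemma chebT_rec (R : realType) (beta gamma : R) (n : nat) (x : R) :
  chebT beta gamma n.+2 x =
  2 * chebT beta gamma 1 x * chebT beta gamma n.+1 x - chebT beta gamma n x.
Proof.
rewrite /chebT.
set c := (2 - beta - gamma)^-1; set t := acos x - _.
have -> : 2 * n.+2%:R * c * t = 2 * n.+1%:R * c * t + 2 * 1%:R * c * t.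
  by rewrite -[n.+2]addn1 natrD; ring.
have -> : 2 * n%:R * c * t = 2 * n.+1%:R * c * t - 2 * 1%:R * c * t.
  by rewrite -[n.+1]addn1 natrD; ring.
rewrite cosB cosD; ring.
Qed.

Lemma primed_sum0 (R : realType) (z : nat -> R) : primed_sum 0 z = 2^-1 * z 0%N.
Proof. by rewrite /primed_sum big_geq ?addr0. Qed.

Lemma primed_sumS (R : realType) (n : nat) (z : nat -> R) :
  primed_sum n.+1 z = primed_sum n z + z n.+1.
Proof. by rewrite /primed_sum big_nat_recr //= addrA. Qed.

(** Christoffel-Darboux identity, in division-free form, for two sequences that
    obey the Chebyshev recurrence with the initial values of the first kind. *)
Lemma christoffel_darboux (R : realType) (p q : nat -> R) (n : nat) :
  p 0%N = 1 -> q 0%N = 1 ->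
  (forall k, p k.+2 = 2 * p 1%N * p k.+1 - p k) ->
  (forall k, q k.+2 = 2 * q 1%N * q k.+1 - q k) ->
  2 * (p 1%N - q 1%N) * primed_sum n (fun j => p j * q j) =
  p n.+1 * q n - p n * q n.+1.
Proof.
move=> p0 q0 pS qS; elim: n => [|n IHn].
  by rewrite primed_sum0 p0 q0; field.
rewrite primed_sumS mulrDr IHn pS qS; ring.
Qed.

Theorem theorem1 (R : realType) (beta gamma : R)
    (hbeta : 0 <= beta < 2) (hgamma : 0 <= gamma < 2)
    (hbg : beta + gamma < 2)
    (n : nat) (hn : (1 <= n)%N)
    (x y : R) (hx : -1 <= x <= 1) (hy : -1 <= y <= 1)
    (hxy : chebT beta gamma 1 x <> chebT beta gamma 1 y) :
  primed_sum n (fun j => chebT beta gamma j x * chebT beta gamma j y) =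
  1 / 2 *
  ((chebT beta gamma n.+1 x * chebT beta gamma n y
    - chebT beta gamma n x * chebT beta gamma n.+1 y)
   / (chebT beta gamma 1 x - chebT beta gamma 1 y)).
Proof.
have d0 : chebT beta gamma 1 x - chebT beta gamma 1 y != 0.
  by rewrite subr_eq0; apply/eqP.
rewrite -(@christoffel_darboux R (fun j => chebT beta gamma j x)
            (fun j => chebT beta gamma j y)) ?chebT0 //.
- by field.
- by move=> k; apply: chebT_rec.
- by move=> k; apply: chebT_rec.
Qed.
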